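(* Let $G$ and $H$ be graphs with $n$ and $m$ vertices, respectively, and let $S \subseteq V(G)\times V(H)$ (the common vertex set of $G \square H$ and $G \boxtimes H$). If every vertex in $S$ is adjacent in $G \square H$ to at least two vertices of $(V(G)\times V(H)) \setminus S$, then $F(G \boxtimes H) \geq |S|$. In particular, if in addition $|S| = F(G \square H)$, then $F(G \boxtimes H) \geq \max\{mF(G), nF(H)\}$.
   Context: All graphs are simple, finite and undirected. The Cartesian product $G \square H$ has vertex set $V(G)\times V(H)$, with $(u,v)$ adjacent to $(u',v')$ iff either $u=u'$ and $vv'\in E(H)$, or $v=v'$ and $uu'\in E(G)$. The strong product $G \boxtimes H$ has vertex set $V(G)\times V(H)$, with $(u,v)$ adjacent to $(u',v')$ iff ($uu'\in E(G)$ and $vv'\in E(H)$), or ($u=u'$ and $vv'\in E(H)$), or ($v=v'$ and $uu'\in E(G)$). Zero forcing: each vertex is blue or white; starting from an initial set $S$ of blue vertices, repeatedly apply the color-change rule: if a blue vertex $u$ has exactly one white neighbor $v$, color $v$ blue. $S$ is a zero forcing set if eventually all vertices are blue, and a failed zero forcing set otherwise. $F(G)$ denotes the maximum cardinality of a failed zero forcing set of $G$. *)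

(* Defs.v *)
From mathcomp Require Import all_boot.

Set Implicit Arguments.
Unset Strict Implicit.
Unset Printing Implicit Defensive.

Record sgraph := SGraph {
  vertex :> finType;
  adj : rel vertex;
  adj_sym : symmetric adj;
  adj_irrefl : irreflexive adj }.

Section Products.
Variables G H : sgraph.

Definition cart_adj : rel (vertex G * vertex H) := fun x y =>
  ((x.1 == y.1) && adj x.2 y.2) || ((x.2 == y.2) && adj x.1 y.1).

Definition strong_adj : rel (vertex G * vertex H) := fun x y =>
  [|| adj x.1 y.1 && adj x.2 y.2,
      (x.1 == y.1) && adj x.2 y.2
    | (x.2 == y.2) && adj x.1 y.1].

Lemma cart_adj_sym : symmetric cart_adj.
Proof.
move=> x y; rewrite /cart_adj (eq_sym x.1) (eq_sym x.2).
by rewrite (adj_sym x.1) (adj_sym x.2).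
Qed.

Lemma cart_adj_irrefl : irreflexive cart_adj.
Proof. by move=> x; rewrite /cart_adj !adj_irrefl !andbF. Qed.

Lemma strong_adj_sym : symmetric strong_adj.
Proof.
move=> x y; rewrite /strong_adj (eq_sym x.1) (eq_sym x.2).
by rewrite (adj_sym x.1) (adj_sym x.2).
Qed.

Lemma strong_adj_irrefl : irreflexive strong_adj.
Proof. by move=> x; rewrite /strong_adj !adj_irrefl !andbF. Qed.

Definition cart_prod : sgraph := SGraph cart_adj_sym cart_adj_irrefl.
Definition strong_prod : sgraph := SGraph strong_adj_sym strong_adj_irrefl.

End Products.

Section ZeroForcing.
Variable G : sgraph.
Implicit Types B C S : {set G}.

Definition white_nbrs B (u : G) : {set G} := [set v | adj u v & v \notin B].

(* One application of the color-change rule, which colors a single vertex. *)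
Definition color_change : rel {set G} := fun B C =>
  [exists u in B, exists v, (white_nbrs B u == [set v]) && (C == v |: B)].

Definition zero_forcing S : bool := connect color_change S [set: G].

(* The empty set is failed as soon as G has a vertex, so the maximum then
   ranges over a nonempty family; it is 0 for the graph without vertices. *)
Definition failed_zf_number : nat :=
  \max_(S : {set G} | ~~ zero_forcing S) #|S|.

End ZeroForcing.

(* Main.v *)
Require Import Defs.
From mathcomp Require Import all_boot.

(** A set is failed iff it is contained in a stalled set (one to which the
color-change rule no longer applies) that misses some vertex. The set S is
stalled in the strong product because strong neighborhoods contain Cartesian
ones. If B is stalled and proper in G, then B x V(H) is stalled and proper in
the Cartesian product, so F of the Cartesian product is at least m F(G), and
symmetrically at least n F(H). *)

(** The full set qualifies too, since its vertices have no white neighbors; hence the separate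
    condition [B != setT] below. *)
Definition stalled {G : sgraph} (B : {set G}) : bool :=
  [forall u in B, #|white_nbrs B u| != 1].

Lemma stalledP {G : sgraph} (B : {set G}) :
  reflect (forall C, ~~ color_change B C) (stalled B).
Proof.
apply: (iffP forall_inP) => [stB C | noB u uB].
  apply/exists_inP => -[u uB /existsP[v /andP[/eqP wE _]]].
  by have := stB u uB; rewrite wE cards1.
apply/negP => /cards1P[v wE]; have /negP := noB (v |: B); apply.
by apply/exists_inP; exists u => //; apply/existsP; exists v; rewrite wE !eqxx.
Qed.

Lemma color_change_proper {G : sgraph} (B C : {set G}) :
  color_change B C -> B \proper C.
Proof.
case/exists_inP=> u _ /existsP[v /andP[/eqP wE /eqP->]].
apply: properUr; rewrite sub1set.
by have := set11 v; rewrite -wE inE => /andP[].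
Qed.

Lemma connect_color_change_sub {G : sgraph} (B C : {set G}) :
  connect (@color_change G) B C -> B \subset C.
Proof.
case/connectP=> p; elim: p B => [|D p IHp] B /= => [_ -> //|].
case/andP=> /color_change_proper/proper_sub BD pD eC.
exact: subset_trans BD (IHp D pD eC).
Qed.

(** A nontrivial path of color changes would need a first step out of [B], so [B] reaches only
    itself. *)
Lemma stalled_failed {G : sgraph} (B : {set G}) :
  stalled B -> B != setT -> ~~ zero_forcing B.
Proof.
move=> /stalledP stB; apply: contra => /connectP[[|C p] /=].
  by move=> _ ->.
by rewrite (negPf (stB C)).
Qed.

(** Take a largest set reachable from [S]: any further color change would strictly enlarge it. *)
Lemma failed_sub_stalled {G : sgraph} (S : {set G}) :
  ~~ zero_forcing S ->
  exists2 B : {set G}, S \subset B & stalled B && (B != setT).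
Proof.
move=> failS.
case: (arg_maxnP (fun B : {set G} => #|B|) (connect0 (@color_change G) S)).
move=> B SB maxB; exists B; first exact: connect_color_change_sub.
apply/andP; split; last by apply: contraNneq failS => BT; rewrite /zero_forcing -BT.
apply/stalledP => C; apply/negP => BC.
have := maxB C (connect_trans SB (connect1 BC)).
by apply/negP; rewrite -ltnNge proper_card // color_change_proper.
Qed.

Lemma leq_failed_zf_number {G : sgraph} (B : {set G}) :
  stalled B -> B != setT -> #|B| <= failed_zf_number G.
Proof.
by move=> stB BT; apply: leq_bigmax_cond; apply: stalled_failed.
Qed.

(** Positivity excludes the maximum over an empty family, whose default value 0 is the size of no
    failed set. When the number is 0, the products bounded below vanish anyway. *)
Lemma failed_zf_number_gt0_stalled (G : sgraph) :
  0 < failed_zf_number G ->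
  exists2 B : {set G}, failed_zf_number G <= #|B| & stalled B && (B != setT).
Proof.
move=> F0; have [S failS|noS] := pickP (fun S : {set G} => ~~ zero_forcing S);
  last by move: F0; rewrite /failed_zf_number big_pred0.
have [|S0 failS0 FE] := @eq_bigmax_cond _
  [pred S : {set G} | ~~ zero_forcing S] (fun S : {set G} => #|S|).
  by apply/card_gt0P; exists S.
have [B SB BP] := failed_sub_stalled _ failS0.
by exists B => //; rewrite [failed_zf_number G]FE subset_leq_card.
Qed.

(** The neighbors of [(u, v)] with first coordinate [u] are all blue, so its white neighbors are the
    copies in the layer of [v] of those of [u], and the two counts agree. *)
Lemma stalled_setXT {G H : sgraph} (B : {set G}) :
  stalled B -> stalled (setX B [set: H] : {set cart_prod G H}).
Proof.
move=> /forall_inP stB; apply/forall_inP => -[u v].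
rewrite in_setX => /andP[/= uB _].
suff -> : white_nbrs (setX B [set: H] : {set cart_prod G H}) (u, v)
          = [set (w, v) | w in white_nbrs B u].
  by rewrite card_imset ?stB // => w w' [].
apply/setP=> -[a b]; rewrite !inE /= andbT /cart_adj /=.
apply/idP/imsetP => [/andP[/orP[]/andP[/eqP eq_uv adj_uv] aB]|[w]].
- by rewrite -eq_uv uB in aB.
- by exists a; rewrite ?inE ?adj_uv -?eq_uv.
- by rewrite inE => /andP[uw wB] [-> ->]; rewrite eqxx uw wB orbT.
Qed.

Lemma stalled_setTX {G H : sgraph} (B : {set H}) :
  stalled B -> stalled (setX [set: G] B : {set cart_prod G H}).
Proof.
move=> /forall_inP stB; apply/forall_inP => -[u v].
rewrite in_setX => /andP[/= _ vB].
suff -> : white_nbrs (setX [set: G] B : {set cart_prod G H}) (u, v)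
          = [set (u, w) | w in white_nbrs B v].
  by rewrite card_imset ?stB // => w w' [].
apply/setP=> -[a b]; rewrite !inE /= /cart_adj /=.
apply/idP/imsetP => [/andP[/orP[]/andP[/eqP eq_uv adj_uv] bB]|[w]].
- by exists b; rewrite ?inE ?adj_uv -?eq_uv.
- by rewrite -eq_uv vB in bB.
- by rewrite inE => /andP[vw wB] [-> ->]; rewrite eqxx vw wB.
Qed.

Lemma failed_zf_number_cart_l (G H : sgraph) :
  #|H| * failed_zf_number G <= failed_zf_number (cart_prod G H).
Proof.
(* A vertex of [H] is needed for properness: without one, [setX B setT] is the whole (empty)
   product. *)
have [->|H0] := posnP #|H|; first by rewrite mul0n.
have [->|F0] := posnP (failed_zf_number G); first by rewrite muln0.
have [B FB /andP[stB BT]] := failed_zf_number_gt0_stalled _ F0.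
apply: leq_trans (leq_mul (leqnn _) FB) _.
rewrite mulnC -cardsT -cardsX.
apply: leq_failed_zf_number; first exact: stalled_setXT.
have [v _] := card_gt0P H0.
apply: contraNneq BT => BHT; apply/eqP/setP => u.
by have := in_setT (u, v); rewrite -BHT !inE andbT.
Qed.

Lemma failed_zf_number_cart_r (G H : sgraph) :
  #|G| * failed_zf_number H <= failed_zf_number (cart_prod G H).
Proof.
have [->|G0] := posnP #|G|; first by rewrite mul0n.
have [->|F0] := posnP (failed_zf_number H); first by rewrite muln0.
have [B FB /andP[stB BT]] := failed_zf_number_gt0_stalled _ F0.
apply: leq_trans (leq_mul (leqnn _) FB) _.
rewrite -cardsT -cardsX.
apply: leq_failed_zf_number; first exact: stalled_setTX.
have [u _] := card_gt0P G0.
apply: contraNneq BT => GBT; apply/eqP/setP => v.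
by have := in_setT (u, v); rewrite -GBT !inE.
Qed.

Lemma cart_white_nbrs_strong {G H : sgraph} (S : {set G * H}) (x : G * H) :
  white_nbrs (S : {set cart_prod G H}) x
    \subset white_nbrs (S : {set strong_prod G H}) x.
Proof.
apply/subsetP => y; rewrite !inE /= => /andP[xy ->]; rewrite andbT.
by apply/orP; right.
Qed.

Theorem theorem3p8 (G H : sgraph) (n m : nat)
    (hn : #|G| = n) (hm : #|H| = m) (S : {set G * H})
    (hS : forall x : G * H, x \in S ->
      2 <= #|[set y : G * H | adj (s := cart_prod G H) x y & y \notin S]|) :
  #|S| <= failed_zf_number (strong_prod G H) /\
  (#|S| = failed_zf_number (cart_prod G H) ->
   maxn (m * failed_zf_number G) (n * failed_zf_number H)
     <= failed_zf_number (strong_prod G H)).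
Proof.
have leS : #|S| <= failed_zf_number (strong_prod G H).
  (* A nonempty [S] is proper because a vertex of [S] has a neighbor outside [S]. *)
  have [->|[x xS]] := set_0Vmem S; first by rewrite cards0.
  apply: (@leq_failed_zf_number (strong_prod G H)).
    (* The two white Cartesian neighbors are also white strong neighbors, so the count exceeds 1. *)
    apply/forall_inP => y yS; rewrite neq_ltn; apply/orP; right.
    exact: leq_trans (hS y yS) (subset_leq_card (cart_white_nbrs_strong S y)).
  have /ltnW/card_gt0P[y] := hS x xS; rewrite inE => /andP[_].
  by apply: contraNneq => ->; rewrite inE.
split=> // SF; apply: leq_trans leS; rewrite SF -hn -hm geq_max.
by rewrite failed_zf_number_cart_l failed_zf_number_cart_r.
Qed.
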